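(* Let $(M,\mathcal F,g_\intercal)$ be a transversely time-oriented Lorentzian foliation whose leaf space $M/\mathcal F$ is Hausdorff. If $(M,\mathcal F,g_\intercal)$ is transversely $K$-causal, then it admits a transverse time function.
   Context: $M$ is a connected smooth manifold of dimension $n\ge 3$. $\mathcal F$ is a regular foliation of codimension $q\geq 2$: a partition of $M$ into connected immersed submanifolds (leaves), locally given by the fibers of a submersion. $T\mathcal F\subset TM$ is the (vertical) distribution tangent to the leaves; vectors in $T\mathcal F$, and vector fields with values in it, are called vertical. $M/\mathcal F$ is the leaf space with the quotient topology. A transverse Lorentzian metric on $(M,\mathcal F)$ is a smooth symmetric $(0,2)$-tensor field $g_\intercal$ on $M$ with $\mathcal L_Vg_\intercal=0$ for all vertical $V$, such that at each $x$ the bilinear form $g_\intercal(x)$ has index $1$ and its kernel is exactly $T_x\mathcal F$. The triple $(M,\mathcal F,g_\intercal)$ is then called a Lorentzian foliation. A nonvertical vector $v$ is transversely causal if $g_\intercal(v,v)\le 0$. The set of transversely causal vectors at $x$ has two connected components (causal wedges); a transverse time orientation is a continuous choice of one of them (the future causal wedge) at each point. A future-directed transversely causal curve is a piecewise smooth curve whose tangent vectors lie in the future causal wedges. For leaves $L,L'$, write $L\le_{M/\mathcal F}L'$ if $L=L'$ or there is a future-directed transversely causal curve from a point of $L$ to a point of $L'$. $J^+_{M/\mathcal F}:=\{(L,L'):L\le_{M/\mathcal F}L'\}\subset M/\mathcal F\times M/\mathcal F$. Transverse $K^+$ relation $K^+_\intercal$: the smallest closed (in the product topology) and transitive relation on $M/\mathcal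 F$ containing $J^+_{M/\mathcal F}$. $\overline{\Delta_{M/\mathcal F}}$ is the closure of the diagonal in $M/\mathcal F\times M/\mathcal F$. Transversely $K$-causal: $(\hat x,\hat y),(\hat y,\hat x)\in K^+_\intercal$ implies $(\hat x,\hat y)\in\overline{\Delta_{M/\mathcal F}}$. A transverse time function is a continuous $f:M\to\mathbb R$ such that for every future-directed transversely causal curve $\alpha:[a,b]\to M$ and all $t,s\in[a,b]$, $t<s\Rightarrow f(\alpha(t))<f(\alpha(s))$. *)

(* Defs.v *)
From HB Require Import structures.
From mathcomp Require Import all_boot all_order all_algebra generic_quotient.
From mathcomp Require Import all_classical all_reals all_analysis.

Set Implicit Arguments.
Unset Strict Implicit.
Unset Printing Implicit Defensive.

Import Order.TTheory GRing.Theory Num.Theory.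
Import numFieldNormedType.Exports.

Local Open Scope classical_set_scope.
Local Open Scope ring_scope.
Local Open Scope quotient_scope.

Section SmoothOn.
Context {R : realType} {V W : normedModType R}.

(* [Cr r O f]: f is of class C^r on O. It is only used for O open, where
   pointwise continuity and differentiability in the ambient space are the
   usual notions on O, and (V being finite-dimensional) the directional
   derivatives stand for all partial derivatives. *)
Fixpoint Cr (r : nat) (O : set V) (f : V -> W) : Prop :=
  if r is s.+1 then
    (forall x, O x -> differentiable f x) /\ (forall v, Cr s O ('D_v f))
  else forall x, O x -> {for x, continuous f}.

Definition smooth_on (O : set V) (f : V -> W) : Prop := forall r, Cr r O f.

End SmoothOn.

(* The values of [cmap] off [dom] and of [cinv] off [cmap @` dom] are
   irrelevant. *)
Record chart (R : realType) (T : topologicalType) (n : nat) := Chart {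
  dom : set T;
  cmap : T -> 'rV[R]_n;
  cinv : 'rV[R]_n -> T;
  dom_open : open dom;
  cod_open : open (cmap @` dom);
  cmap_continuous : forall x, dom x -> {for x, continuous cmap};
  cinv_continuous : forall u, (cmap @` dom) u -> {for u, continuous cinv};
  cmapK : forall x, dom x -> cinv (cmap x) = x
}.

(* The atlas need not be maximal. [chart_at x] is a chosen chart around x; it
   serves to identify the tangent space at x with row vectors, see below. *)
Record manifold (R : realType) (n : nat) := Manifold {
  carrier :> topologicalType;
  atlas : set (chart R carrier n);
  chart_at : carrier -> chart R carrier n;
  chart_at_atlas : forall x, atlas (chart_at x);
  chart_at_dom : forall x, dom (chart_at x) x;
  atlas_smooth : forall c d, atlas c -> atlas d ->
    smooth_on (cmap c @` (dom c `&` dom d)) (cmap d \o cinv c);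
  manifold_hausdorff : hausdorff_space carrier;
  manifold_second_countable : @second_countable carrier
}.

Section Tangent.
Context {R : realType} {n : nat} (M : manifold R n).

(* T_xM is 'rV[R]_n, a vector being given by its components in the chart
   [chart_at x]. A vector field is thus a map M -> 'rV[R]_n; since [chart_at]
   may jump from point to point, regularity is always tested on the components
   in a fixed chart. *)

(* components in the chart c of the tangent vector v at x *)
Definition tcoord (c : chart R M n) (x : M) (v : 'rV[R]_n) : 'rV[R]_n :=
  'D_v (cmap c \o cinv (chart_at x)) (cmap (chart_at x) x).

(* the tangent vector at x whose components in the chart c are a *)
Definition tvec (c : chart R M n) (x : M) (a : 'rV[R]_n) : 'rV[R]_n :=
  'D_a (cmap (chart_at x) \o cinv c) (cmap c x).

Definition vfield_comp (c : chart R M n) (X : M -> 'rV[R]_n) (u : 'rV[R]_n) :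
  'rV[R]_n := tcoord c (cinv c u) (X (cinv c u)).

Definition smooth_vfield (X : M -> 'rV[R]_n) : Prop :=
  forall c, atlas c -> smooth_on (cmap c @` dom c) (vfield_comp c X).

Definition continuous_vfield_on (O : set M) (X : M -> 'rV[R]_n) : Prop :=
  forall c, atlas c -> forall u, (cmap c @` (dom c `&` O)) u ->
    {for u, continuous (vfield_comp c X)}.

Definition bil (A : 'M[R]_n) (v w : 'rV[R]_n) : R := (v *m A *m w^T) 0 0.

(* A (0,2)-tensor field assigns to x the Gram matrix g x of a bilinear form on
   T_xM = 'rV[R]_n; [tensor_comp c g] is its matrix of components in c. *)
Definition tensor_comp (c : chart R M n) (g : M -> 'M[R]_n) (u : 'rV[R]_n) :
  'M[R]_n :=
  \matrix_(i, j) bil (g (cinv c u)) (tvec c (cinv c u) (delta_mx 0 i))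
                                    (tvec c (cinv c u) (delta_mx 0 j)).

Definition smooth_tensor (g : M -> 'M[R]_n) : Prop :=
  forall c, atlas c -> smooth_on (cmap c @` dom c) (tensor_comp c g).

(* (L_X g)(a, b) = X (g(a, b)) - g([X, a], b) - g(a, [X, b]) computed in the
   chart c, where a and b are constant fields, so that [X, a] = - D_a X. *)
Definition lie_derivative (c : chart R M n) (X : M -> 'rV[R]_n)
    (g : M -> 'M[R]_n) (u a b : 'rV[R]_n) : R :=
  let G := tensor_comp c g in
  let Xc := vfield_comp c X in
  bil ('D_(Xc u) G u) a b + bil (G u) ('D_a Xc u) b + bil (G u) a ('D_b Xc u).

Definition negative_definite_on (A : 'M[R]_n) (S : 'M[R]_n) : Prop :=
  forall v : 'rV[R]_n, (v <= S)%MS -> v != 0 -> bil A v v < 0.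

(* the index is the maximal dimension of a negative definite subspace *)
Definition has_index (A : 'M[R]_n) (k : nat) : Prop :=
  (exists S : 'M[R]_n, \rank S = k /\ negative_definite_on A S) /\
  (forall S : 'M[R]_n, negative_definite_on A S -> (\rank S <= k)%N).

Definition form_kernel (A : 'M[R]_n) : set 'rV[R]_n :=
  [set v | forall w, bil A v w = 0].

(* Parametrized curves are total functions R -> M of which only the
   restriction to an interval matters. *)
Definition smooth_curve_on (I : set R) (alpha : R -> M) : Prop :=
  (forall t, I t -> {for t, continuous alpha}) /\
  (forall c, atlas c ->
    @smooth_on R R^o _ (I `&` alpha @^-1` dom c) (cmap c \o alpha)).

Definition velocity (alpha : R -> M) (t : R) : 'rV[R]_n :=
  derive1 (cmap (chart_at (alpha t)) \o alpha) t.

Definition submersion_on (q : nat) (U : set M) (s : M -> 'rV[R]_q) : Prop :=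
  (forall c, atlas c -> smooth_on (cmap c @` (dom c `&` U)) (s \o cinv c)) /\
  (forall x, U x -> forall w : 'rV[R]_q, exists v : 'rV[R]_n,
    'D_v (s \o cinv (chart_at x)) (cmap (chart_at x) x) = w).

End Tangent.

Section SmoothMaps.
Context {R : realType} {p n : nat} {N : manifold R p} {M : manifold R n}.

Definition smooth_map (f : N -> M) : Prop :=
  continuous f /\
  (forall c d, atlas c -> atlas d ->
    smooth_on (cmap c @` (dom c `&` f @^-1` dom d)) (cmap d \o f \o cinv c)).

Definition tangent_map (f : N -> M) (z : N) (w : 'rV[R]_p) : 'rV[R]_n :=
  'D_w (cmap (chart_at (f z)) \o f \o cinv (chart_at z)) (cmap (chart_at z) z).

Definition injective_immersion (f : N -> M) : Prop :=
  [/\ smooth_map f, injective f &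
      forall z w, tangent_map f z w = 0 -> w = 0].

End SmoothMaps.

(* Leaves are connected immersed submanifolds, with their own topology. Locally
   they are the fibers of submersions: each fiber of s : U -> R^q lies in a
   leaf, and s is locally constant along each leaf for the leaf topology (so
   that the fibers are open subsets of the leaves). *)
Record foliation (R : realType) (n : nat) (M : manifold R n) (q : nat) :=
  Foliation {
  leaf_index : Type;
  leaf : leaf_index -> manifold R (n - q);
  incl : forall l, leaf l -> M;
  incl_immersion : forall l, injective_immersion (@incl l);
  leaf_connected : forall l, connected [set: leaf l];
  leaf_partition :
    partition [set: leaf_index] (fun l => range (@incl l)) [set: M];
  fol_submersion : forall x : M, exists (U : set M) (s : M -> 'rV[R]_q),
    [/\ open U, U x, submersion_on U s,
        (forall y z, U y -> U z -> s y = s z ->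
          exists l, range (@incl l) y /\ range (@incl l) z) &
        (forall l (z : leaf l), U (incl z) ->
          \forall z' \near z, s (incl z') = s (incl z))]
}.

Arguments leaf {R n M q} F l : rename.
Arguments incl {R n M q} F l z : rename.

Section LeafSpace.
Context {R : realType} {n q : nat} {M : manifold R n} (F : foliation M q).

Definition same_leaf (x y : M) : bool :=
  `[< exists l, range (incl F l) x /\ range (incl F l) y >].

Lemma same_leaf_refl : reflexive same_leaf.
Proof.
move=> x; apply/asboolP; have [cov _ _] := leaf_partition F.
have : [set: M] x by [].
by rewrite -cov => -[l _ lx]; exists l.
Qed.

Lemma same_leaf_sym : symmetric same_leaf.
Proof.
by move=> x y; apply/asboolP/asboolP => -[l [? ?]]; exists l.
Qed.

Lemma same_leaf_trans : transitive same_leaf.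
Proof.
move=> y x z /asboolP[l [lx ly]] /asboolP[l' [l'y l'z]]; apply/asboolP.
have [_ triv _] := leaf_partition F.
have ll' : l = l' by apply: triv => //; exists y.
by exists l; split=> //; rewrite ll'.
Qed.

Canonical same_leaf_equiv :=
  EquivRel same_leaf same_leaf_refl same_leaf_sym same_leaf_trans.

Definition leaf_space : topologicalType :=
  quotient_topology {eq_quot same_leaf}.

Definition leaf_proj : M -> leaf_space :=
  fun x => \pi_(quotient_topology {eq_quot same_leaf}) x.

(* T_xF, the tangent space at x of the leaf through x *)
Definition vertical (x : M) : set 'rV[R]_n :=
  [set v | exists l (z : leaf F l) (w : 'rV[R]_(n - q)),
     incl F l z = x /\ tangent_map (incl F l) z w = v].

Definition vertical_vfield (X : M -> 'rV[R]_n) : Prop :=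
  smooth_vfield X /\ forall x, vertical x (X x).

Record transverse_lorentzian (g : M -> 'M[R]_n) : Prop := {
  tl_sym : forall x, (g x)^T = g x;
  tl_smooth : smooth_tensor g;
  tl_lie : forall X, vertical_vfield X ->
    forall c, atlas c -> forall u, (cmap c @` dom c) u ->
    forall a b, lie_derivative c X g u a b = 0;
  tl_index : forall x, has_index (g x) 1;
  tl_kernel : forall x, form_kernel (g x) = vertical x
}.

Variable g : M -> 'M[R]_n.

Definition transversely_causal (x : M) : set 'rV[R]_n :=
  [set v | ~ vertical x v /\ bil (g x) v v <= 0].

(* W x is the future causal wedge at x. Continuity of the choice: locally W
   contains the values of a continuous vector field. *)
Definition transverse_time_orientation (W : M -> set 'rV[R]_n) : Prop :=
  (forall x, exists2 v, transversely_causal x v &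
     W x = connected_component (transversely_causal x) v) /\
  (forall x, exists (O : set M) (X : M -> 'rV[R]_n),
     [/\ open O, O x, continuous_vfield_on O X & forall y, O y -> W y (X y)]).

Variable W : M -> set 'rV[R]_n.

(* A piece of curve is smooth on the closed interval [c, d] if it extends to a
   smooth curve on a larger open interval; its tangent vectors at c and d are
   then the one-sided derivatives. *)
Definition future_causal_piece (c d : R) (alpha : R -> M) : Prop :=
  exists (e : R) (beta : R -> M),
    [/\ 0 < e, smooth_curve_on `]c - e, d + e[ beta &
        forall t, t \in `[c, d] ->
          beta t = alpha t /\ W (beta t) (velocity beta t)].

Definition future_causal_curve (a b : R) (alpha : R -> M) : Prop :=
  [/\ a < b, {within `[a, b], continuous alpha} &
      exists2 s : seq R, itv_partition a b s &
        forall i, (i < size s)%N ->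
          future_causal_piece (nth b (a :: s) i) (nth b s i) alpha].

Definition leaf_le (L L' : leaf_space) : Prop :=
  L = L' \/
  exists a b alpha, [/\ future_causal_curve a b alpha,
    leaf_proj (alpha a) = L & leaf_proj (alpha b) = L'].

Definition Jplus : set (leaf_space * leaf_space) :=
  [set LL | leaf_le LL.1 LL.2].

Definition transitive_rel (A : set (leaf_space * leaf_space)) : Prop :=
  forall x y z, A (x, y) -> A (y, z) -> A (x, z).

Definition Kplus : set (leaf_space * leaf_space) :=
  smallest [set A | closed A /\ transitive_rel A] Jplus.

Definition transversely_K_causal : Prop :=
  forall x y, Kplus (x, y) -> Kplus (y, x) -> closure diagonal (x, y).

Definition transverse_time_function (f : M -> R) : Prop :=
  continuous f /\
  (forall a b alpha, future_causal_curve a b alpha ->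
    forall t s, t \in `[a, b] -> s \in `[a, b] -> t < s ->
      f (alpha t) < f (alpha s)).

End LeafSpace.

(* Main.v *)
(* Pulled back to M along the leaf projection, K^+ becomes a closed preorder.
   M being second countable, locally compact and Hausdorff, Levin's theorem
   provides a continuous isotone function, strictly increasing along the strict
   part of this preorder: working up a compact exhaustion one sees that a closed
   decreasing set and a disjoint closed increasing set have disjoint open
   decreasing and increasing neighbourhoods, Urysohn's dyadic construction then
   separates points by isotone functions, and countably many of them are summed.
   It remains to see that a causal curve is strictly increasing for K^+. If not,
   antisymmetry of K^+ on the Hausdorff leaf space confines an arc of the curve
   to one leaf; a local submersion defining the foliation takes only countably
   many values on a leaf, hence is constant along the arc, and the velocity is
   vertical, which contradicts causality. *)
From mathcomp Require Import all_boot all_order all_algebra.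
From mathcomp Require Import generic_quotient lra.
From mathcomp Require Import all_classical all_reals all_analysis.
Require Import Defs.

Set Implicit Arguments.
Unset Strict Implicit.
Unset Printing Implicit Defensive.

Import Order.TTheory GRing.Theory Num.Theory.
Import numFieldNormedType.Exports.

Local Open Scope classical_set_scope.
Local Open Scope ring_scope.

(** * Continuous utilities for closed preorders *)

(** Tube argument: if [z] lies above no point of [A], closedness of [K] gives a product
    neighbourhood of each [(y, z)], and compactness of [A] leaves one neighbourhood of [z] that
    serves every [y]. *)
Lemma closed_upset_compact (T : topologicalType) (K : T -> T -> Prop)
    (A : set T) : closed [set p | K p.1 p.2] -> compact A ->
  closed [set z | exists2 y, A y & K y z].
Proof.
move=> cK /compact_near_coveringP cA; rewrite -openC openE => z /= zA.
have /(cA _ (nbhs z) (fun z' y' => ~ K y' z')) : forall y, A y ->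
    \forall y' \near y & z' \near z, ~ K y' z'.
  move=> y Ay; have : ~ K y z by move=> Kyz; apply: zA; exists y.
  have : open (~` [set p : T * T | K p.1 p.2]) by rewrite openC.
  rewrite openE => /(_ (y, z)) + nK => /(_ nK) /=.
  rewrite /interior /= => [[[P Q] /= [Py Qz] PQ]].
  by exists (P, Q) => //= -[y' z'] /= /PQ.
by apply: filterS => z' H [y Ay]; exact: H.
Qed.

Definition up_closed (T : Type) (K : T -> T -> Prop) (A : set T) :=
  forall x y, A x -> K x y -> A y.

Lemma exp2_small (R : realType) (e : R) : 0 < e -> exists n, 4 / 2 ^+ n <= e.
Proof.
move=> e0; exists (Num.truncn (4 / e)).+1.
rewrite ler_pdivrMr ?exprn_gt0// mulrC -ler_pdivrMr//.
apply: (le_trans (ltW (truncnS_gt _))).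
by rewrite -natrX ler_nat ltnW// ltn_expl.
Qed.

(** * Normality of closed preorders on spaces exhausted by compact sets *)

Section ClosedPreorder.
Context {T : topologicalType} (K : T -> T -> Prop).
Hypothesis hausT : hausdorff_space T.
Hypothesis Kxx : forall x, K x x.
Hypothesis Ktrans : forall x y z, K x y -> K y z -> K x z.
Hypothesis Kclosed : closed [set p | K p.1 p.2].
Variable C : nat -> set T.
Hypothesis C0 : C 0 = set0.
Hypothesis Ccompact : forall n, compact (C n).
Hypothesis Cmono : forall n, C n `<=` C n.+1.
Hypothesis Ccover : forall x, exists n, (C n)° x.

(** With the reversed preorder, [up_closed K'] means decreasing, so results on increasing sets also
    yield those on decreasing ones. *)
Let K' x y := K y x.

Let K'closed : closed [set p | K' p.1 p.2].
Proof.
have -> : [set p | K' p.1 p.2] = 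
    (fun p => (p.2, p.1)) @^-1` [set p | K p.1 p.2].
  by apply/seteqP; split => -[].
apply: preimage_closed => // p _; exact: cvg_pair cvg_snd cvg_fst.
Qed.

Let Cle m n : (m <= n)%N -> C m `<=` C n.
Proof.
elim: n => [|n IH]; first by rewrite leqn0 => /eqP ->.
rewrite leq_eqVlt => /predU1P[-> //|]; rewrite ltnS => /IH h.
exact: subset_trans h (@Cmono n).
Qed.

Lemma compact_sub_exhaustion (A : set T) : compact A ->
  exists n, A `<=` (C n)°.
Proof.
move=> /compact_near_coveringP cA.
have /(cA _ \oo (fun n => (C n)°)) : forall x, A x ->
    \forall x' \near x & n \near \oo, (C n)° x'.
  move=> x _; have [n nx] := Ccover x.
  exists ((C n)°, [set m | (n <= m)%N]) => /=.
    split; last by exists n.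
    by apply: open_nbhs_nbhs; split=> //; exact: open_interior.
  by move=> [x' m] /= [nx' nm]; move: nx'; exact/interiorS/Cle.
by case=> N _ /(_ N (leqnn N)) h; exists N.
Qed.

Lemma compact_closed_nbhs (A O : set T) : compact A -> open O -> A `<=` O ->
  exists U N, [/\ open U, closed N, A `<=` U, U `<=` N & N `<=` O].
Proof.
move=> cA oO AO; have [n An] := compact_sub_exhaustion cA.
have clA := compact_closed hausT cA.
have /(_ O) := compact_normal_local hausT (@Ccompact n) An clA.
have : set_nbhs A O by apply/set_nbhsP; exists O; split.
move=> AO' /(_ AO')[V /set_nbhsP[U [oU AU UV]] VO].
exists U, (closure V); split => //; first exact: closed_closure.
exact: subset_trans UV (@subset_closure _ _).
Qed.

(** The set of points above [B] is closed and misses [A], which gives [N]. Once [N] is cut down to a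
    compact set, the set of points below it is closed and misses [B], which gives [P]. *)
Lemma separated_nbhs (A B : set T) : compact A -> compact B ->
    (forall x y, A x -> B y -> ~ K y x) ->
  exists U V N P, [/\ open U, open V, closed N & closed P] /\
    [/\ A `<=` U, B `<=` V, U `<=` N, V `<=` P &
        forall x y, N x -> P y -> ~ K y x].
Proof.
move=> cA cB AB.
have cl1 := closed_upset_compact Kclosed cB.
have [||U [N [oU cN AU UN NA]]] :=
    compact_closed_nbhs (O := ~` [set z | exists2 y, B y & K y z]) cA.
- by rewrite openC.
- by move=> x Ax [y By]; exact: AB.
have [m Am] := compact_sub_exhaustion cA.
have cptN : compact (N `&` C m) by rewrite setIC; exact: compact_closedI.
have cl2 := closed_upset_compact K'closed cptN.
have [||V [P [oV cP BV VP PB]]] := compact_closed_nbhs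
    (O := ~` [set z | exists2 y, (N `&` C m) y & K' y z]) cB.
- by rewrite openC.
- by move=> y By [x [Nx _] Kyx]; apply: (NA x Nx); exists y.
exists (U `&` (C m)°), V, (N `&` C m), P; split; split => //.
- by apply: openI => //; exact: open_interior.
- exact: compact_closed.
- by move=> x Ax; split; [exact: AU|exact: Am].
- by move=> x [/UN Nx /interior_subset Cx].
- by move=> x y Nx Py Kyx; apply: (PB y Py); exists x.
Qed.

(* Monotonicity is only required relative to C n, which is what allows the two
   sets to be compact. *)
Let stage (A B : set T) (n : nat) (UV : set T * set T) :=
  [/\ compact UV.1, compact UV.2, UV.1 `<=` C n & UV.2 `<=` C n] /\
  [/\ (forall x y, C n x -> UV.1 y -> K x y -> UV.1 x),
      (forall x y, C n y -> UV.2 x -> K x y -> UV.2 y),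
      A `&` C n `<=` UV.1, B `&` C n `<=` UV.2 &
      forall x y, UV.1 x -> UV.2 y -> ~ K y x].

(** The open set [O] leaves room around each set of stage [n] inside the following one; this makes
    the unions over all stages open. *)
Let next (n : nat) (UV UV' : set T * set T) :=
  (exists2 O, open O & UV.1 `<=` O /\ O `&` C n.+1 `<=` UV'.1) /\
  (exists2 O, open O & UV.2 `<=` O /\ O `&` C n.+1 `<=` UV'.2).

(** After adding the traces of [A] and [B] on [C n.+1], the two compact sets are separated by [N]
    and [P]; the new stage consists of the decreasing hull of [N] and the increasing hull of [P],
    formed inside [C n.+1]. *)
Let stage_next A B n UV : closed A -> closed B -> up_closed K' A ->
    up_closed K B -> A `&` B = set0 -> stage A B n UV ->
  exists UV', stage A B n.+1 UV' /\ next n UV UV'.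
Proof.
move=> cA cB dA uB AB [[cU cV UC VC] [dU uV AU BV UV0]].
pose A' := UV.1 `|` (A `&` C n.+1); pose B' := UV.2 `|` (B `&` C n.+1).
have cA' : compact A'.
  by apply: compactU => //; rewrite setIC; exact: compact_closedI.
have cB' : compact B'.
  by apply: compactU => //; rewrite setIC; exact: compact_closedI.
have [|U [V [N [P [[oU oV cN cP] [A'U B'V UN VP NP]]]]]] :=
    separated_nbhs cA' cB'.
  (* In the mixed cases, monotonicity of [A] or [B] moves membership along [Kyx] to a point of
     [C n], which then lies in both sets of stage [n]. *)
  move=> x y [Ux|[Ax Cx]] [Vy|[By Cy]] Kyx.
  - exact: UV0 Kyx.
  - by apply: (UV0 x x) => //; apply: BV; split; [exact: uB Kyx|exact: UC].
  - by apply: (UV0 y y) => //; apply: AU; split; [exact: (dA x)|exact: VC].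
  - suff : (A `&` B) y by rewrite AB.
    by split=> //; exact: (dA x).
have cptN : compact (N `&` C n.+1) by rewrite setIC; exact: compact_closedI.
have cptP : compact (P `&` C n.+1) by rewrite setIC; exact: compact_closedI.
exists ([set x | exists2 y, (N `&` C n.+1) y & K' y x] `&` C n.+1,
        [set x | exists2 y, (P `&` C n.+1) y & K y x] `&` C n.+1).
split; split; [split|split| |] => //=.
- rewrite setIC; apply: compact_closedI => //.
  exact: closed_upset_compact K'closed cptN.
- rewrite setIC; apply: compact_closedI => //.
  exact: closed_upset_compact Kclosed cptP.
- move=> x y Cx [[z zN Kyz] Cy] Kxy; split=> //; exists z => //.
  exact: Ktrans Kxy Kyz.
- move=> x y Cy [[z zP Kzx] Cx] Kxy; split=> //; exists z => //.
  exact: Ktrans Kzx Kxy.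
- move=> x [Ax Cx]; split=> //; exists x; last exact: Kxx.
  by split=> //; apply: UN; apply: A'U; right.
- move=> x [Bx Cx]; split=> //; exists x; last exact: Kxx.
  by split=> //; apply: VP; apply: B'V; right.
- move=> x y [[x' [Nx' _] Kxx'] _] [[y' [Py' _] Ky'y] _] Kyx.
  by apply: (NP x' y') => //; apply: Ktrans Ky'y _; apply: Ktrans Kyx _.
- exists U => //; split; first by move=> x Ux; apply: A'U; left.
  by move=> x [Ux Cx]; split=> //; exists x; [split=> //; exact: UN|exact: Kxx].
- exists V => //; split; first by move=> x Vx; apply: B'V; left.
  by move=> x [Vx Cx]; split=> //; exists x; [split=> //; exact: VP|exact: Kxx].
Qed.

(** [U] and [V] are the unions of the stages. Monotonicity relative to each [C n] becomes global,
    since any two points lie in a common [C n]. *)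
Lemma preorder_normal (A B : set T) : closed A -> closed B ->
    up_closed K' A -> up_closed K B -> A `&` B = set0 ->
  exists U V, [/\ open U, open V, up_closed K' U & up_closed K V] /\
    [/\ A `<=` U, B `<=` V & U `&` V = set0].
Proof.
move=> cA cB dA uB AB.
have ex n UV : exists UV', stage A B n UV ->
    stage A B n.+1 UV' /\ next n UV UV'.
  have [h|h] := pselect (stage A B n UV); last by exists UV.
  by have [UV' ?] := stage_next cA cB dA uB AB h; exists UV'.
(* The empty pair is a valid stage 0 because [C 0] is empty. *)
pose F := fix F n := if n is m.+1 then projT1 (cid (ex m (F m)))
                     else (set0, set0).
have FS n : stage A B n (F n).
  elim: n => [|n IH]; last by have [] := projT2 (cid (ex n (F n))) IH.
  by split; split; rewrite /= ?C0 ?setI0//; exact: compact0.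
have FN n : next n (F n) (F n.+1).
  by have [] := projT2 (cid (ex n (F n))) (FS n).
clearbody F; clear ex.
have F1S n : (F n).1 `<=` (F n.+1).1.
  have [[_ _ UC _] _] := FS n; have [[W _ [UO OC]] _] := FN n.
  by move=> x Ux; apply: OC; split; [exact: UO|exact/Cmono/UC].
have F2S n : (F n).2 `<=` (F n.+1).2.
  have [[_ _ _ VC] _] := FS n; have [_ [W _ [VO OC]]] := FN n.
  by move=> x Vx; apply: OC; split; [exact: VO|exact/Cmono/VC].
have F1le m n : (m <= n)%N -> (F m).1 `<=` (F n).1.
  elim: n => [|n IH]; first by rewrite leqn0 => /eqP ->.
  rewrite leq_eqVlt => /predU1P[-> //|]; rewrite ltnS => /IH h.
  exact: subset_trans h (F1S n).
have F2le m n : (m <= n)%N -> (F m).2 `<=` (F n).2.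
  elim: n => [|n IH]; first by rewrite leqn0 => /eqP ->.
  rewrite leq_eqVlt => /predU1P[-> //|]; rewrite ltnS => /IH h.
  exact: subset_trans h (F2S n).
have openF (G : nat -> set T) : (forall m n, (m <= n)%N -> G m `<=` G n) ->
    (forall n, exists2 O, open O & G n `<=` O /\ O `&` C n.+1 `<=` G n.+1) ->
    open (\bigcup_n G n).
  move=> Gle GO; rewrite openE => x -[m _ Gx].
  have [k kx] := Ccover x; pose n := maxn m k.
  have Gn : G n x by apply: Gle Gx; exact: leq_maxl.
  have [W oW [GnW WG]] := GO n.
  have : nbhs x (W `&` (C n.+1)°).
    apply: open_nbhs_nbhs; split.
      by apply: openI => //; exact: open_interior.
    split; first exact: GnW.
    by move: kx; apply/interiorS/Cle/leqW; exact: leq_maxr.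
  apply: filterS => y [Wy Cy]; exists n.+1 => //; apply: WG; split=> //.
  exact: interior_subset Cy.
exists (\bigcup_n (F n).1), (\bigcup_n (F n).2); split; split.
- by apply: openF => // n; have [] := FN n.
- by apply: openF => // n; have [] := FN n.
- move=> x y [n _ Ux] Kyx; have [m my] := Ccover y.
  exists (maxn m n) => //; have [_ [dU _ _ _ _]] := FS (maxn m n).
  apply: dU Kyx; last by apply: F1le Ux; exact: leq_maxr.
  by move/interior_subset : my; apply: Cle; exact: leq_maxl.
- move=> x y [n _ Vx] Kxy; have [m my] := Ccover y.
  exists (maxn m n) => //; have [_ [_ uV _ _ _]] := FS (maxn m n).
  apply: uV Kxy; last by apply: F2le Vx; exact: leq_maxr.
  by move/interior_subset : my; apply: Cle; exact: leq_maxl.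
- move=> x Ax; have [n /interior_subset nx] := Ccover x; exists n => //.
  by have [_ [_ _ AU _ _]] := FS n; apply: AU.
- move=> x Bx; have [n /interior_subset nx] := Ccover x; exists n => //.
  by have [_ [_ _ _ BV _]] := FS n; apply: BV.
- apply/seteqP; split => // x [[m _ Ux] [n _ Vx]].
  have [_ [_ _ _ _ sep]] := FS (maxn m n).
  apply: (sep x x); last exact: Kxx.
  + by apply: F1le Ux; exact: leq_maxl.
  + by apply: F2le Vx; exact: leq_maxr.
Qed.

(** * Urysohn's construction for isotone functions *)

Section Urysohn.
Variable R : realType.

(** A substitute for the closure of [A] lying in the interior of [B]: closures and interiors of
    decreasing sets need not be decreasing, so decreasing [D] and [W] are interposed explicitly. *)
Let prec (A B : set T) := [/\ up_closed K' A, up_closed K' B &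
  exists D W, [/\ closed D, open W, up_closed K' D & up_closed K' W] /\
              [/\ A `<=` D, D `<=` W & W `<=` B]].

Let prec_sub A B : prec A B -> A `<=` B.
Proof.
move=> [_ _ [D [W [_ [AD DO OB]]]]].
exact: subset_trans AD (subset_trans DO OB).
Qed.

(** Normality applied to [D] and the complement of [W] gives [U] and [V]; the open [U] is interposed
    on the left of the new set, the closed complement of [V] on its right. *)
Let prec_interp A B : prec A B -> exists U, prec A U /\ prec U B.
Proof.
move=> [dA dB [D [W [[cD oO dD dO] [AD DO OB]]]]].
have [|||U [V [[oU oV dU uV] [DU OV UV]]]] :=
    @preorder_normal D (~` W) cD _ dD.
- by rewrite closedC.
- by move=> x y nWx Kxy Wy; apply: nWx; exact: dO Kxy.
- by apply/seteqP; split => // x [/DO].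
exists U; split; split => //.
  by exists D, U; split; split.
exists (~` V), W; split; split => //.
- by rewrite closedC.
- by move=> x y nVx Kyx Vy; apply: nVx; exact: uV Kyx.
- by move=> x Ux Vx; have : (U `&` V) x by []; rewrite UV.
- by move=> x nVx; apply: contrapT => /OV.
Qed.

Lemma preorder_urysohn (A B : set T) : closed A -> closed B ->
    up_closed K' A -> up_closed K B -> A `&` B = set0 ->
  exists f : T -> R, [/\ continuous f, (forall x y, K x y -> f x <= f y),
    (forall x, 0 <= f x <= 2), (forall x, A x -> f x = 0) &
    (forall x, B x -> 1 <= f x)].
Proof.
move=> cA cB dA uB AB.
have interpP P : exists U, prec P.1 P.2 -> prec P.1 U /\ prec U P.2.
  have [/prec_interp[U PU]|nP] := pselect (prec P.1 P.2); first by exists U.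
  by exists set0.
have {interpP} [interp interpP] := choice interpP.
(* [S n k] is the sublevel set attached to the dyadic number k / 2^n. Level 0 has [A] at 0, the
   complement of [B] at 1 and the whole space from 2 on, so that every point has finite value; each
   level interpolates at odd [k]. *)
pose S := fix S n k := if n is m.+1 then
    (if odd k then interp (S m k./2, S m k./2.+1) else S m k./2)
  else (if k is k'.+1 then if k' is _.+1 then setT else ~` B else A).
have dBc : up_closed K' (~` B).
  by move=> x y nBx Kyx By; apply: nBx; exact: uB Kyx.
have S0P k : prec (S 0%N k) (S 0%N k.+1).
  case: k => [|[|k]]; split=> //=.
  - exists A, (~` B); split; split => //; rewrite ?openC //.
    by move=> x Ax Bx; have : (A `&` B) x by []; rewrite AB.
  - by exists setT, setT; split; split => //; (exact: closedT || exact: openT).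
  - by exists setT, setT; split; split => //; (exact: closedT || exact: openT).
have SP n k : prec (S n k) (S n k.+1).
  elim: n k => [|n IH] k; first exact: S0P.
  have [h1 h2] := interpP (S n k./2, S n k./2.+1) (IH k./2).
  rewrite /= uphalf_half; case: (odd k) => //=.
have SD n m k : S (m + n)%N (k * 2 ^ m)%N = S n k.
  elim: m => [|m IH]; first by rewrite expn0 muln1.
  by rewrite expnS mulnCA mul2n addSn /= odd_double doubleK.
have Sle n k l : (k <= l)%N -> S n k `<=` S n l.
  elim: l => [|l IH]; first by rewrite leqn0 => /eqP ->.
  rewrite leq_eqVlt => /predU1P[-> //|]; rewrite ltnS => /IH h.
  exact: subset_trans h (prec_sub (SP n l)).
have S2 n x : S n (2 * 2 ^ n)%N x by have := SD 0%N n 2%N; rewrite addn0 => ->.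
have S00 : S 0%N 0%N = A by [].
have S01 : S 0%N 1%N = ~` B by [].
clearbody S; clear interp interpP.
pose E x : set R := [set r | exists n k, S n k x /\ r = k%:R / 2 ^+ n].
have E0 x : lbound (E x) 0.
  by move=> _ [n [k [_ ->]]]; rewrite divr_ge0// exprn_ge0.
have E2 x : E x 2.
  exists 0%N, 2%N; split; last by rewrite expr0 divr1.
  by have := S2 0%N x; rewrite expn0 muln1.
pose f x := inf (E x).
have f_le n k x : S n k x -> f x <= k%:R / 2 ^+ n.
  by move=> Sx; apply: ge_inf; [exists 0|exists n, k].
have f_ge n k x : ~ S n k x -> k%:R / 2 ^+ n <= f x.
  move=> nSx; apply: lb_le_inf; first by exists 2.
  (* If i / 2^m were below k / 2^n, refining both to level m + n would put [x] in [S n k]. *)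
  move=> _ [m [i [Sx ->]]].
  rewrite ler_pdivrMr ?exprn_gt0// mulrAC ler_pdivlMr ?exprn_gt0//.
  rewrite -!natrX -!natrM ler_nat leqNgt; apply/negP => /ltnW lt.
  by apply: nSx; rewrite -(SD n m); apply: Sle lt _ _; rewrite addnC SD.
have f0 x : 0 <= f x by apply: lb_le_inf; [exists 2|exact: E0].
have f2 x : f x <= 2 by apply: ge_inf; [exists 0|].
exists f; split.
- move=> x; apply/cvgrPdist_le => e e0.
  have [n ne] := exp2_small e0.
  (* With [k] minimal, f x lies between (k - 1) / 2^n and k / 2^n. Membership in [S n k] and failure
     of membership in [S n (k - 1)] each cost one more dyadic step to hold near [x], whence the
     bounds k + 1 and k - 2 for f y. *)
  have exk : exists k, `[< S n k x >] by exists (2 * 2 ^ n)%N; apply/asboolP.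
  case: (ex_minnP exk) => k /asboolP Sk kmin.
  have nSk j : (j < k)%N -> ~ S n j x.
    by move=> jk /asboolP /kmin; rewrite leqNgt jk.
  have lo : (k%:R - 1) / 2 ^+ n <= f x.
    case: k nSk {Sk kmin} => [_|k /(_ _ (ltnSn k)) /f_ge].
      apply: le_trans (f0 x).
      by rewrite ler_pdivrMr ?exprn_gt0// mul0r sub0r lerN10.
    by rewrite -[in X in _ -> X](@natr1 R k) addrK.
  have nhi : \forall y \near x, f y <= (k%:R + 1) / 2 ^+ n.
    have [_ _ [D [W [[_ oO _ _] [SD' DO OS]]]]] := SP n k.
    have : nbhs x W by apply: open_nbhs_nbhs; split=> //; exact/DO/SD'.
    by apply: filterS => y /OS /f_le; rewrite natr1.
  have nlo : \forall y \near x, (k%:R - 2) / 2 ^+ n <= f y.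
    case: k nSk {Sk kmin lo nhi} => [|[|k]] nSk.
    + apply: nearW => y; apply: le_trans (f0 y).
      by rewrite ler_pdivrMr ?exprn_gt0// mul0r sub0r oppr_le0.
    + apply: nearW => y; apply: le_trans (f0 y).
      by rewrite ler_pdivrMr ?exprn_gt0// mul0r subr_le0 ler_nat.
    have [_ _ [D [W [[cD _ _ _] [SD' DO OS]]]]] := SP n k.
    have : nbhs x (~` D).
      apply: open_nbhs_nbhs; split; first by rewrite openC.
      by move=> /DO/OS; apply: nSk.
    apply: filterS => y nDy.
    have -> : k.+2%:R - 2 = k%:R :> R by rewrite -addn2 natrD addrK.
    by apply: f_ge => /SD'.
  near=> y.
  have h1 := f_le _ _ _ Sk.
  have h2 : f y <= (k%:R + 1) / 2 ^+ n by near: y.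
  have h3 : (k%:R - 2) / 2 ^+ n <= f y by near: y.
  rewrite (le_trans _ ne)// ler_norml; apply/andP; split; lra.
- move=> x y Kxy; apply: lb_le_inf; first by exists 2.
  move=> _ [n [k [Sy ->]]]; apply: f_le.
  by have [dS _ _] := SP n k; exact: dS Kxy.
- by move=> x; rewrite f0 f2.
- move=> x Ax; apply/eqP; rewrite eq_le f0 andbT.
  by apply: le_trans (@f_le 0%N 0%N x _) _; rewrite ?mul0r// S00.
- move=> x Bx; apply: le_trans (@f_ge 0%N 1%N x _);
  by rewrite ?expr0 ?divr1// S01.
Unshelve. all: by end_near. Qed.

End Urysohn.

(** The points below [a] and the points above [b] form disjoint closed sets, to which the Urysohn
    construction applies. *)
Lemma preorder_separation (R : realType) (a b : T) : ~ K b a ->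
  exists f : T -> R, [/\ continuous f, (forall x y, K x y -> f x <= f y),
    (forall x, 0 <= f x <= 2) & f a < f b].
Proof.
move=> nKba.
have cl1 := closed_upset_compact Kclosed (@compact_set1 T b).
have cl2 := closed_upset_compact K'closed (@compact_set1 T a).
have [|||f [cf mf f02 fA fB]] := preorder_urysohn R cl2 cl1.
- by move=> x y [_ -> Kxa] Kyx; exists a => //; exact: Ktrans Kyx Kxa.
- by move=> x y [_ -> Kbx] Kxy; exists b => //; exact: Ktrans Kbx Kxy.
- apply/seteqP; split => // x [[_ -> Kxa] [_ -> Kbx]].
  by apply: nKba; exact: Ktrans Kbx Kxa.
exists f; split => //; rewrite fA; last by exists a => //; exact: Kxx.
by apply: lt_le_trans (fB b _); [exact: ltr01|exists b => //; exact: Kxx].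
Qed.
End ClosedPreorder.

(** * Countable bases and compact exhaustions *)

Lemma countable_enum (T : Type) (A : set (set T)) : countable A ->
  exists b : nat -> set T, forall U, A U -> exists n, b n = U.
Proof.
move=> /countable_injP[e einj].
exists (fun n => xget set0 [set U | A U /\ e U = n]) => U AU; exists (e U).
have [] := @xgetPex _ set0 [set V | A V /\ e V = e U]
  (ex_intro _ U (conj AU erefl)) => AX eX.
by apply: einj => //; exact/mem_set.
Qed.

(** By local compactness the basic open sets having a compact superset cover the space; stage [n] is
    the union of the supersets chosen for the first [n] basic sets. *)
Lemma compact_exhaustion (T : topologicalType) : @second_countable T ->
    (forall x : T, exists2 N, nbhs x N & compact N) ->
  exists C : nat -> set T, [/\ C 0%N = set0, (forall n, compact (C n)),
    (forall n, C n `<=` C n.+1) & forall x, exists n, (C n)° x].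
Proof.
move=> [B cB [Bo Bx]] lc; have [b bP] := countable_enum cB.
have /choice[k kP] n : exists N, compact N /\
    ((exists2 N', compact N' & b n `<=` N') -> b n `<=` N).
  have [[N cN bN]|h] := pselect (exists2 N, compact N & b n `<=` N).
    by exists N.
  by exists set0; split=> //; exact: compact0.
exists (fun n => \big[setU/set0]_(i < n) k i); split.
- by rewrite big_ord0.
- by move=> n; apply: bigsetU_compact => i _; case: (kP i).
- by move=> n; rewrite big_ord_recr /= => x; left.
- move=> x; have [N xN cN] := lc x; have [U [BU Ux] UN] := Bx x N xN.
  have [n bn] := bP U BU; exists n.+1.
  have : nbhs x U by apply: open_nbhs_nbhs; split=> //; exact: Bo.
  apply: filterS; rewrite big_ord_recr /= => y Uy; right.
  by case: (kP n) => _; rewrite bn; apply=> //; exists N.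
Qed.

(** * Sums of isotone functions and strict monotonicity *)

Section Utility.
Context {R : realType} {T : topologicalType} (K : T -> T -> Prop).

(** f is the sum of the g n / 2^n, taken as the supremum of the partial sums. A strict increase of
    one term survives because all the other terms are isotone. *)
Lemma countable_utility (g : nat -> T -> R) :
    (forall n, continuous (g n)) ->
    (forall n x y, K x y -> g n x <= g n y) ->
    (forall n x, 0 <= g n x <= 2) ->
  exists f : T -> R, [/\ continuous f, (forall x y, K x y -> f x <= f y) &
    forall x y n, K x y -> g n x < g n y -> f x < f y].
Proof.
move=> cg mg bg.
pose s n x := \sum_(k < n) g k x / 2 ^+ k.
have sS n x : s n.+1 x = s n x + g n x / 2 ^+ n by rewrite /s big_ord_recr.
have p2 n : 0 < 2 ^+ n :> R by rewrite exprn_gt0.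
have cs n : continuous (s n).
  elim: n => [|n IH] x.
    have -> : s 0%N = cst 0 by apply/funext => y; rewrite /s big_ord0.
    exact: cvg_cst.
  have -> : s n.+1 = (fun y => s n y + g n y / 2 ^+ n).
    by apply/funext => y; rewrite sS.
  by apply: cvgD; [exact: IH|apply: cvgMr_tmp; exact: cg].
have ss x m n : (m <= n)%N -> s m x <= s n x.
  elim: n => [|n IH]; first by rewrite leqn0 => /eqP ->.
  rewrite leq_eqVlt => /predU1P[-> //|]; rewrite ltnS => /IH h.
  rewrite sS (le_trans h)// lerDl divr_ge0 ?(ltW (p2 n))//.
  by case/andP: (bg n x).
(* g <= 2 makes the upper estimates s n + 4 / 2 ^ n nonincreasing *)
have st x m n : (m <= n)%N -> s n x + 4 / 2 ^+ n <= s m x + 4 / 2 ^+ m.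
  elim: n => [|n IH]; first by rewrite leqn0 => /eqP ->.
  rewrite leq_eqVlt => /predU1P[-> //|]; rewrite ltnS => /IH; apply: le_trans.
  rewrite sS exprS invfM -addrA lerD2l mulrA -mulrDl ler_pM2r ?invr_gt0//.
  by case/andP: (bg n x) => _ h; lra.
have sb x m n : s n x <= s m x + 4 / 2 ^+ m.
  have [mn|/ltnW nm] := leqP m n.
    by apply: le_trans (st x _ _ mn); rewrite lerDl divr_ge0 ?ltW.
  by apply: le_trans (ss x _ _ nm) _; rewrite lerDl divr_ge0 ?ltW.
pose f x := sup (range (s^~ x)).
have sf n x : s n x <= f x.
  by apply: ub_le_sup; [exists (s 0%N x + 4 / 2 ^+ 0) => _ [m _ <-]|exists n].
have fs n x : f x <= s n x + 4 / 2 ^+ n.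
  by apply: ge_sup; [exists (s 0%N x), 0%N|move=> _ [m _ <-]].
have mgs x y n : K x y -> s n x <= s n y.
  move=> Kxy; apply: ler_sum => k _; rewrite ler_pM2r ?invr_gt0//.
  exact: mg.
exists f; split.
- move=> x; apply/cvgrPdist_le => e e0.
  have [|n ne] := @exp2_small R (e / 3); first by rewrite divr_gt0.
  have /cvgrPdist_le/(_ (e / 3)) : s n y @[y --> x] --> s n x by exact: cs.
  rewrite divr_gt0// => /(_ isT); apply: filterS => y; rewrite !ler_norml.
  have := sf n x; have := sf n y; have := fs n x; have := fs n y.
  by move=> h1 h2 h3 h4 /andP[h5 h6]; apply/andP; split; lra.
- move=> x y Kxy; apply: ge_sup; first by exists (s 0%N x), 0%N.
  by move=> _ [n _ <-]; apply: le_trans (sf n y); exact: mgs.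
- move=> x y n Kxy gxy.
  have d0 : 0 < (g n y - g n x) / 2 ^+ n by rewrite divr_gt0// subr_gt0.
  suff : f x <= f y - (g n y - g n x) / 2 ^+ n by lra.
  apply: ge_sup; first by exists (s 0%N x), 0%N.
  move=> _ [m _ <-]; rewrite lerBrDr.
  (* Summing at least up to n + 1 terms ensures that the strictly increasing term [n] is present. *)
  have h1 := ss x _ _ (leq_maxl m n.+1).
  apply: le_trans (sf (maxn m n.+1) y).
  apply: le_trans (_ : s (maxn m n.+1) x + (g n y - g n x) / 2 ^+ n <= _).
    by rewrite lerD2r.
  have nm : (n < maxn m n.+1)%N by rewrite leq_maxr.
  rewrite /s (bigD1 (Ordinal nm)) //= [leRHS](bigD1 (Ordinal nm)) //=.
  rewrite addrAC -mulrDl addrC subrKC addrC lerD2l.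
  by apply: ler_sum => k _; rewrite ler_pM2r ?invr_gt0//; exact: mg.
Qed.

(* Levin's theorem. *)
Lemma closed_preorder_utility : hausdorff_space T -> @second_countable T ->
    (forall x : T, exists2 N, nbhs x N & compact N) ->
    (forall x, K x x) -> (forall x y z, K x y -> K y z -> K x z) ->
    closed [set p | K p.1 p.2] ->
  exists f : T -> R, [/\ continuous f, (forall x y, K x y -> f x <= f y) &
    forall x y, K x y -> ~ K y x -> f x < f y].
Proof.
move=> hT sT lc Kxx Ktr cK.
have [C [C0 Cc Cm Cx]] := compact_exhaustion sT lc.
have sep := preorder_separation hT Kxx Ktr cK C0 Cc Cm Cx R.
have [B cB [Bo Bx]] := sT; have [b bP] := countable_enum cB.
pose good (p : nat * nat) (f : T -> R) :=
  forall x y, b p.1 x -> b p.2 y -> f x < f y.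
pose iso (f : T -> R) := [/\ continuous f, (forall x y, K x y -> f x <= f y) &
  (forall x, 0 <= f x <= 2)].
(* For each pair of basic open sets, an isotone function separating them is chosen if there is one,
   and zero otherwise; this leaves countably many functions. *)
have /choice[g gP] p : exists f, iso f /\
    ((exists2 f', iso f' & good p f') -> good p f).
  have [[f fi fg]|h] := pselect (exists2 f, iso f & good p f).
    by exists f.
  exists (cst 0); split => //; split => //.
    by move=> x; exact: cvg_cst.
  by move=> x; rewrite lexx ler0n.
pose h n := g (odflt (0, 0)%N (unpickle n)).
have [||| f [cf mf sf]] := @countable_utility h.
- by move=> n; case: (gP (odflt (0, 0)%N (unpickle n))) => -[].
- by move=> n; case: (gP (odflt (0, 0)%N (unpickle n))) => -[].
- by move=> n; case: (gP (odflt (0, 0)%N (unpickle n))) => -[].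
exists f; split => // x y Kxy nKyx.
have [u [cu mu u02 uxy]] := sep x y nKyx.
(* Basic neighbourhoods on which [u] stays on either side of the midpoint form a pair separated by
   [u], so the function chosen for that pair separates [x] from [y]. *)
pose c := (u x + u y) / 2.
have [U [BU Ux] Uc] : filter_from [set U | B U /\ U x] id
    (u @^-1` [set r | r < c]).
  apply: Bx; apply: cu; apply: open_nbhs_nbhs; split; first exact: open_lt.
  by rewrite /= /c; lra.
have [V [BV Vy] Vc] : filter_from [set U | B U /\ U y] id
    (u @^-1` [set r | c < r]).
  apply: Bx; apply: cu; apply: open_nbhs_nbhs; split; first exact: open_gt.
  by rewrite /= /c; lra.
have [i bi] := bP U BU; have [j bj] := bP V BV.
apply: (sf x y (pickle (i, j))) => //; rewrite /h pickleK /=.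
have [_ ] := gP (i, j); apply; last 2 first.
- by rewrite /= bi.
- by rewrite /= bj.
exists u => // x' y'; rewrite /= bi bj => /Uc /= h1 /Vc /= h2.
exact: lt_trans h1 h2.
Qed.

End Utility.

(** * Curves contained in a leaf *)

(** By the intermediate value theorem the image contains the interval between [f a] and [f b], which
    has positive length if they differ, whereas countable sets are null. *)
Lemma continuous_countable_range_eq (R : realType) (f : R -> R) (a b : R) :
  a <= b -> {within `[a, b], continuous f} -> countable (f @` `[a, b]) ->
  f a = f b.
Proof.
move=> ab cf ctb; apply: contrapT => /eqP fab.
pose m := Num.min (f a) (f b); pose m' := Num.max (f a) (f b).
have mm' : m < m' by rewrite /m /m' lt_max !gt_min !ltxx /= orbF orbC -neq_lt.
have sub : `[m, m']%classic `<=` f @` `[a, b].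
  move=> v /=; rewrite in_itv /= => vm.
  by have [c cab <-] := IVT ab cf vm; exists c.
have := countable_lebesgue_measure0 (sub_countable (subset_card_le sub) ctb).
rewrite lebesgue_measure_itv /= lte_fin mm' => /eqP.
by rewrite -EFinB eqe subr_eq0 gt_eqF.
Qed.

Lemma Cr_subset (R : realType) (V W : normedModType R) r (O O' : set V)
  (f : V -> W) : O' `<=` O -> Cr r O f -> Cr r O' f.
Proof.
move=> OO; elim: r f => [|r IH] f /=; first by move=> h x /OO /h.
by move=> [h1 h2]; split=> [x /OO /h1//|v]; exact: IH.
Qed.

Lemma smooth_on_differentiable (R : realType) (V W : normedModType R)
    (O : set V) (f : V -> W) x : smooth_on O f -> O x -> differentiable f x.
Proof. by move=> /(_ 1%N)[h _]; exact: h. Qed.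

Section Manifold.
Context {R : realType} {n : nat} (M : manifold R n).

Lemma manifold_locally_compact (x : M) : exists2 N, nbhs x N & compact N.
Proof.
pose c := chart_at x; have cx : dom c x := chart_at_dom x.
have : nbhs (cmap c x) (cmap c @` dom c).
  by apply: open_nbhs_nbhs; split; [exact: cod_open|exists x].
move=> /nbhs_ballP[e /= e0 eB].
(* Half the radius keeps the closed ball inside the image of the chart; it is compact as a closed
   bounded set. *)
pose N := closed_ball (cmap c x) (e / 2).
have Ncod : N `<=` cmap c @` dom c.
  apply: subset_trans eB; rewrite /N closed_ballE ?divr_gt0// => y /=.
  rewrite /closed_ball_ /= -ball_normE /= => h; apply: le_lt_trans h _.
  by rewrite ltr_pdivrMr// ltr_pMr// ltr1n.
exists (cinv c @` N).
  have : nbhs x (dom c `&` cmap c @^-1` N).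
    apply: filterI; first by apply: open_nbhs_nbhs; split; [exact: dom_open|].
    by apply: (cmap_continuous cx); apply/nbhs_ballP; exists (e / 2);
      [rewrite /= divr_gt0|exact: subset_closed_ball].
  by apply: filterS => y [dy Ny]; exists (cmap c y) => //; exact: cmapK.
apply: continuous_compact.
  apply: continuous_in_subspaceT => u /set_mem /Ncod; exact: cinv_continuous.
apply: bounded_closed_compact; last exact: closed_ball_closed.
exists (`|cmap c x| + e / 2); split; first exact: num_real.
move=> r ler y; rewrite /N closed_ballE ?divr_gt0// /closed_ball_ /= => xy.
rewrite (le_trans _ (ltW ler))// -[y](subKr (cmap c x)).
by rewrite (le_trans (ler_normB _ _))// lerD2l.
Qed.

End Manifold.

(** * Submersions defining the foliation, and their values along leaves *)

Section Leaves.
Context {R : realType} {n q : nat} {M : manifold R n} (F : foliation M q).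

(** A dimension count. Let [A] and [B] be the Jacobians of the leaf inclusion and of [s], acting on
    row vectors. Local constancy of [s] on the leaf gives [A *m B = 0]; the immersion has rank n -
    q, which is also the dimension of the kernel of the surjective [B], so the row space of [A] is
    that kernel. *)
Lemma submersion_kernel_vertical (x : M) (U : set M) (s : M -> 'rV[R]_q) v :
    open U -> U x -> submersion_on U s ->
    (forall l (z : leaf F l), U (incl F l z) ->
      \forall z' \near z, s (incl F l z') = s (incl F l z)) ->
    'D_v (s \o cinv (chart_at x)) (cmap (chart_at x) x) = 0 ->
  vertical F x v.
Proof.
move=> oU Ux [smU surj] lc Dv.
have [cov _ _] := leaf_partition F.
have : [set: M] x by []; rewrite -cov => -[l _ [z _ zx]].
rewrite -{}zx in Ux Dv *.
pose c := chart_at (incl F l z); pose d := chart_at z.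
pose h := cmap c \o incl F l \o cinv d; pose p := cmap d z.
have [[ci si] _ imm] := incl_immersion l.
have dz : dom d z := chart_at_dom z.
have cz : dom c (incl F l z) := chart_at_dom _.
have dh : differentiable h p.
  apply: smooth_on_differentiable (si d c _ _) _; try exact: chart_at_atlas.
  by exists z.
have hp : h p = cmap c (incl F l z) by rewrite /h /= cmapK.
have ds : differentiable (s \o cinv c) (cmap c (incl F l z)).
  apply: smooth_on_differentiable (smU c _) _; first exact: chart_at_atlas.
  by exists (incl F l z).
have cp : {for p, continuous (cinv d)} by apply: cinv_continuous; exists z.
have cst_near : {near p, (s \o cinv c) \o h =1 cst (s (incl F l z))}.
  pose P := [set z' | dom c (incl F l z') /\ s (incl F l z') = s (incl F l z)].
  have zP : nbhs (cinv d p) P.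
    rewrite /p cmapK//; apply: filterI; last exact: lc.
    apply: (ci z (dom c)); apply: open_nbhs_nbhs; split=> //.
    exact: dom_open.
  have : nbhs p (cinv d @^-1` P) := cp P zP.
  by apply: filterS => w [dw sw] /=; rewrite /h /= cmapK.
pose A := jacobian h p; pose B := jacobian (s \o cinv c) (h p).
rewrite -hp in ds Dv surj.
have AB0 : A *m B = 0.
  apply/row_matrixP => i; rewrite row0 rowE mulmxA.
  rewrite -deriveEjacobian// -deriveEjacobian//.
  rewrite deriveE// deriveE// -[LHS]/((_ \o 'd h p) _) -diff_comp//.
  rewrite -deriveE; last exact: differentiable_comp.
  by rewrite (near_eq_derive _ cst_near) derive_cst.
have freeA : row_free A.
  rewrite -kermx_eq0; apply/eqP/row_matrixP => i; rewrite row0.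
  apply: (imm z); rewrite /tangent_map -/c -/d -/h -/p deriveEjacobian//.
  by rewrite -/A -row_mul mulmx_ker row0.
have fullB : row_full B.
  rewrite -sub1mx; apply/row_subP => i.
  have [w] := surj _ Ux (row i 1%:M).
  rewrite -/c -hp deriveEjacobian// => <-; exact: submxMl.
have rkB : \rank (kermx B) = (n - q)%N by rewrite mxrank_ker (eqP fullB).
have : (A == kermx B)%MS.
  rewrite -(mxrank_leqif_eq _).2; last by apply/sub_kermxP.
  by rewrite rkB (eqP freeA).
move=> /eqmxP AK.
have : (v <= A)%MS.
  rewrite AK; apply/sub_kermxP; rewrite -deriveEjacobian//.
move=> /submxP[w ->]; exists l, z, w; split=> //.
by rewrite /tangent_map -/c -/d -/h -/p deriveEjacobian.
Qed.

(** The leaf is second countable and [s] is constant on some basic set around each point, so each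
    value is the one picked by [G] on a basic set. *)
Lemma countable_plaques l (U : set M) (T : choiceType) (s : M -> T) (y0 : T) :
    (forall z : leaf F l, U (incl F l z) ->
      \forall z' \near z, s (incl F l z') = s (incl F l z)) ->
  countable [set s (incl F l z) | z in [set z | U (incl F l z)]].
Proof.
move=> lc; have [B cB [_ Bx]] := @manifold_second_countable _ _ (leaf F l).
pose G (b : set (leaf F l)) :=
  xget y0 [set y | exists z, b z /\ s (incl F l z) = y].
apply: (@sub_countable _ _ _ (G @` B)); last first.
  by apply: sub_countable cB; exact: card_image_le.
apply: subset_card_le => _ [z Uz <-].
have [b [Bb bz] bs] : filter_from [set b | B b /\ b z] id
  [set z' | s (incl F l z') = s (incl F l z)] by apply: Bx; exact: lc.
exists b => //; rewrite /G.
have [] := @xgetPex _ y0 [set y | exists z, b z /\ s (incl F l z) = y].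
  by exists (s (incl F l z)), z.
by move=> z' [bz' <-]; exact: bs.
Qed.

(** [beta] is continuous into [M], but not a priori for the leaf topology, so local constancy of [s]
    on the leaf does not apply directly to the curve; countability of the values of [s] replaces
    it. *)
Lemma leaf_velocity_vertical (l : leaf_index F) (c d t0 : R) (beta : R -> M) :
    smooth_curve_on `]c, d[ beta -> t0 \in `]c, d[ ->
    (forall t, t \in `]c, d[ -> range (incl F l) (beta t)) ->
  vertical F (beta t0) (velocity beta t0).
Proof.
move=> [cb sb] t0cd bl.
have [U [s [oU Ux sU fib lc]]] := fol_submersion F (beta t0).
pose k := chart_at (beta t0).
have kx : dom k (beta t0) := chart_at_dom _.
have katl : atlas k := chart_at_atlas _.
have nearU : \forall t \near t0,
    (t \in `]c, d[) /\ (U (beta t) /\ dom k (beta t)).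
  apply: filterI.
    by apply: open_nbhs_nbhs; split=> //; exact: interval_open.
  apply: (cb t0 t0cd (U `&` dom k)); apply: open_nbhs_nbhs; split=> //.
  by apply: openI => //; exact: dom_open.
have dkb t : t \in `]c, d[ -> dom k (beta t) ->
    differentiable (cmap k \o beta : R^o -> _) t.
  by move=> tcd kt; apply: smooth_on_differentiable (sb k katl) _.
have dsk t : U (beta t) -> dom k (beta t) ->
    differentiable (s \o cinv k) (cmap k (beta t)).
  move=> Ut kt; apply: smooth_on_differentiable (sU.1 k katl) _.
  by exists (beta t).
pose sg := (s \o cinv k) \o (cmap k \o beta).
have sg_near : {near t0, sg =1 cst (sg t0)}.
  move: nearU => /nbhs_ballP[e /= e0 eU].
  (* Each component of [s] along the curve is a continuous real function with countably many values,
     hence takes equal values at any two points of the ball. *)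
  have sgab a b i : a <= b -> ball t0 e a -> ball t0 e b -> sg a 0 i = sg b 0 i.
    move=> ab ba bb.
    have abU t : t \in `[a, b] -> 
        (t \in `]c, d[) /\ (U (beta t) /\ dom k (beta t)).
      rewrite in_itv /= => /andP[at_ tb]; apply: eU.
      move: ba bb; rewrite -!ball_normE /= !ltr_norml => /andP[? ?] /andP[? ?].
      by apply/andP; split; lra.
    apply: (@continuous_countable_range_eq _ (fun t => sg t 0 i)) => //.
      apply: continuous_in_subspaceT => t /set_mem /abU[tcd [Ut kt]].
      apply: (@continuous_comp _ _ _ sg (fun y : 'rV[R]_q => y 0 i)).
        apply: (@differentiable_continuous R R^o).
        by apply: differentiable_comp; [exact: dkb|exact: dsk].
      exact: coord_continuous.
    have := @countable_plaques l U _ s 0 (lc l).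
    set Q := (X in countable X) => cQ.
    apply: (@sub_countable _ _ _ ((fun y : 'rV[R]_q => y 0 i) @` Q)).
      apply: subset_card_le => _ [t /abU[tcd [Ut kt]] <-].
      exists (s (beta t)); last by rewrite /sg /= cmapK.
      have [z _ zt] := bl t tcd.
      by exists z; rewrite /= zt.
    by apply: sub_countable cQ; exact: card_image_le.
  apply/nbhs_ballP; exists e => //= t te; apply/rowP => i.
  have t0e : ball t0 e t0 by exact: ballxx.
  by have [le|/ltW le] := leP t t0; [|symmetry]; exact: sgab.
apply: (@submersion_kernel_vertical _ U s) => //.
rewrite -/k /velocity -/k.
have d1 := dkb t0 t0cd kx; have d2 := dsk t0 Ux kx.
rewrite derive1E (deriveE _ d1) (deriveE _ d2).
rewrite -[LHS]/((_ \o 'd (cmap k \o beta : R^o -> _) t0) _) -diff_comp//.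
rewrite -deriveE; last exact: differentiable_comp.
by rewrite (near_eq_derive _ sg_near) derive_cst.
Qed.

End Leaves.

Lemma closure_diagonal_eq (T : topologicalType) (x y : T) :
  hausdorff_space T -> closure diagonal (x, y) -> x = y.
Proof.
move=> hT clxy; apply: hT => A B xA yB.
have [|[a b] [/= /diagonalP <- [/= Aa Ba]]] := clxy (A `*` B).
  by exists (A, B).
by exists a.
Qed.

(** When the first node [c] separates [t] from [u], the comparison passes through [f c]. *)
Lemma itv_partition_strict (R : realType) (f : R -> R) (a b : R) (s : seq R) :
    itv_partition a b s ->
    (forall i, (i < size s)%N -> forall t u, nth b (a :: s) i <= t -> t < u ->
      u <= nth b s i -> f t < f u) ->
  forall t u, a <= t -> t < u -> u <= b -> f t < f u.
Proof.
elim: s a => [a /itv_partition_nil <- _ t u at_ tu ua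
  |c s IH a ps h t u at_ tu ub].
  by have := lt_le_trans (le_lt_trans at_ tu) ua; rewrite ltxx.
have inc := IH c (itv_partition_cons ps) (fun i => h i.+1).
have h0 := h 0%N isT; rewrite /= in h0.
have [uc|cu] := leP u c; first exact: h0.
have [ct|tc] := leP c t; first exact: inc.
by apply: (lt_trans (h0 t c at_ tc (lexx _))); exact: inc.
Qed.

(** * Causal curves and the relation K+ *)

Section LeafSpace.
Context {R : realType} {n q : nat} {M : manifold R n} (F : foliation M q).

Lemma leaf_projP (x y : M) : leaf_proj F x = leaf_proj F y <->
  exists l, range (incl F l) x /\ range (incl F l) y.
Proof.
split; first by move=> /eqmodP /asboolP.
by move=> h; apply/eqmodP/asboolP.
Qed.

Lemma leaf_proj_continuous : continuous (leaf_proj F).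
Proof. exact: pi_continuous. Qed.

Variable W : M -> set 'rV[R]_n.

Lemma future_causal_piece_sub c d c' d' (alpha : R -> M) :
    c <= c' -> d' <= d -> future_causal_piece W c d alpha ->
  future_causal_piece W c' d' alpha.
Proof.
move=> cc dd [e [beta [e0 [cb sb] bW]]]; exists e, beta; split => //.
- have sub : `]c' - e, d' + e[%classic `<=` `]c - e, d + e[%classic.
    by move=> t /=; rewrite !in_itv /= => /andP[? ?]; apply/andP; split; lra.
  split=> [t /sub/cb//|k ak r]; apply: (Cr_subset _ (sb k ak r)).
  by move=> t [/sub].
- move=> t; rewrite in_itv /= => /andP[? ?]; apply: bW.
  by rewrite in_itv /=; apply/andP; split; lra.
Qed.

Lemma future_causal_piece_curve c d (alpha : R -> M) : c < d ->
  future_causal_piece W c d alpha -> future_causal_curve W c d alpha.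
Proof.
move=> cd piece; split => //; last first.
  by exists [:: d]; [exact: itv_partition1|case].
have [e [beta [e0 [cb sb] bW]]] := piece.
apply: (@subspace_eq_continuous _ _ _ beta).
  by move=> t /set_mem /bW[].
apply: continuous_in_subspaceT => t /set_mem /=.
rewrite in_itv /= => /andP[? ?].
by apply: cb; rewrite /= in_itv /=; apply/andP; split; lra.
Qed.

Lemma Jplus_sub_Kplus : Jplus (F:=F) W `<=` Kplus (F:=F) W.
Proof. exact: sub_gen_smallest. Qed.

Lemma Kplus_closed : closed (Kplus (F:=F) W).
Proof. by apply: closed_bigI => A [[]]. Qed.

Lemma Kplus_trans : transitive_rel (Kplus (F:=F) W).
Proof.
move=> x y z xy yz A AP; have [[_ tA] _] := AP.
by apply: (tA x y z); [exact: xy|exact: yz].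
Qed.

Lemma Kplus_refl x : Kplus (F:=F) W (x, x).
Proof. by apply: Jplus_sub_Kplus; left. Qed.

Lemma piece_Kplus c d (alpha : R -> M) t u :
    future_causal_piece W c d alpha -> c <= t -> t <= u -> u <= d ->
  Kplus (F:=F) W (leaf_proj F (alpha t), leaf_proj F (alpha u)).
Proof.
move=> piece ct; rewrite le_eqVlt => /predU1P[-> _|tu ud].
  exact: Kplus_refl.
apply: Jplus_sub_Kplus; right; exists t, u, alpha; split=> //.
by apply: future_causal_piece_curve => //; exact: future_causal_piece_sub piece.
Qed.

Lemma piece_leaves_leaf (g : M -> 'M[R]_n) c d (alpha : R -> M) :
    transverse_time_orientation F g W ->
    hausdorff_space (leaf_space F) -> transversely_K_causal F W ->
    future_causal_piece W c d alpha -> c < d ->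
  ~ Kplus (F:=F) W (leaf_proj F (alpha d), leaf_proj F (alpha c)).
Proof.
move=> [oW _] hH hK piece cd Kdc.
(* The leaf at time [t] lies after the one at [c] and, going on to [d] and back by [Kdc], also
   before it. *)
have same t : c <= t -> t <= d -> leaf_proj F (alpha c) = leaf_proj F (alpha t).
  move=> ct td; apply: closure_diagonal_eq => //; apply: hK.
    exact: piece_Kplus piece (lexx _) ct td.
  apply: Kplus_trans Kdc; exact: piece_Kplus piece ct td (lexx _).
have /leaf_projP[l [lc _]] := erefl (leaf_proj F (alpha c)).
have inl t : c <= t -> t <= d -> range (incl F l) (alpha t).
  move=> ct td; have /leaf_projP[l' [lc' lt']] := same t ct td.
  have [_ triv _] := leaf_partition F.
  suff -> : l = l' by [].
  by apply: triv => //; exists (alpha c).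
have [e [beta [e0 [cb sb] bW]]] := piece.
pose t0 := (c + d) / 2.
have t0cd : t0 \in `]c, d[ by rewrite in_itv /= /t0; apply/andP; split; lra.
have sub : `]c, d[%classic `<=` `]c - e, d + e[%classic.
  by move=> t /=; rewrite !in_itv /= => /andP[? ?]; apply/andP; split; lra.
have vert : vertical F (beta t0) (velocity beta t0).
  apply: (@leaf_velocity_vertical _ _ _ _ _ l c d) => //.
    split=> [t /sub/cb//|k ak r]; apply: (Cr_subset _ (sb k ak r)).
    by move=> t [/sub].
  move=> t; rewrite in_itv /= => /andP[/ltW ct /ltW td].
  have [|-> _] := bW t; first by rewrite in_itv /= ct td.
  exact: inl.
have [|_ Wv] := bW t0; first exact: subset_itv_oo_cc.
(* The wedge is a component of the set of transversely causal vectors, none of which is vertical. *)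
have [v _ Wv0] := oW (beta t0).
by rewrite Wv0 in Wv; have /connected_component_sub[] := Wv.
Qed.

End LeafSpace.

Theorem theorem7p3 (R : realType) (n q : nat) (hn : (3 <= n)%N) (hq : (2 <= q)%N)
    (M : manifold R n) (hM : connected [set: M])
    (F : foliation M q)
    (g : M -> 'M[R]_n) (hg : transverse_lorentzian F g)
    (W : M -> set 'rV[R]_n) (hW : transverse_time_orientation F g W)
    (hH : hausdorff_space (leaf_space F))
    (hK : transversely_K_causal F W) :
  exists f : M -> R, transverse_time_function W f.
Proof.
pose K (x y : M) := Kplus (F:=F) W (leaf_proj F x, leaf_proj F y).
have [|||||| f [cf mf sf]] := @closed_preorder_utility R M K.
- exact: manifold_hausdorff.
- exact: manifold_second_countable.
- exact: manifold_locally_compact.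
- by move=> x; exact: Kplus_refl.
- by move=> x y z; exact: Kplus_trans.
- have -> : [set p | K p.1 p.2] = (fun p => (leaf_proj F p.1, leaf_proj F p.2))
      @^-1` Kplus (F:=F) W by [].
  apply: preimage_closed; last exact: Kplus_closed.
  have c1 : continuous (leaf_proj F \o @fst M M).
    move=> p; apply: continuous_comp; first exact: cvg_fst.
    exact: leaf_proj_continuous.
  have c2 : continuous (leaf_proj F \o @snd M M).
    move=> p; apply: continuous_comp; first exact: cvg_snd.
    exact: leaf_proj_continuous.
  by move=> p _; exact: cvg_pair (c1 p) (c2 p).
exists f; split => // a b alpha [ab _ [s ps pieces]] t u.
rewrite !in_itv /= => /andP[at_ _] /andP[_ ub] tu.
(* Strictness is only needed inside a single smooth piece, where the arc from [r] to [v] is again a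
   future causal piece. *)
apply: (itv_partition_strict (f := f \o alpha) ps) at_ tu ub.
move=> i si r v ir rv vi /=.
have piece := future_causal_piece_sub ir vi (pieces i si).
apply: sf; first exact: piece_Kplus piece (lexx _) (ltW rv) (lexx _).
exact: piece_leaves_leaf hW hH hK piece rv.
Qed.
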